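(* Let $K$ be a field, $S=K[x_1,\ldots,x_n]$, let $u\ne1$ be a squarefree monomial in $S$, let $I=B_1(u)$ be the squarefree principal Borel ideal with Borel generator $u$, and let $B_1$ be the first block of $u$. Let $h=\operatorname{height}(I)$. Then an ideal $P$ of $S$ is a minimal prime ideal of $I$ of height $h$ if and only if $P=P_A$ for some $A\subseteq[1,\max(B_1)]$ with $|A|=h$. In particular, the multiplicity of $S/I$ is $$e(S/I)=\binom{\max(B_1)}{|B_1|-1}.$$
   Context: $[a,b]$ is the set of integers $c$ with $a\le c\le b$. For a set $A\subseteq\{1,\ldots,n\}$, $P_A=(x_i: i\in A)$. $\operatorname{supp}(u)=\{i:x_i\mid u\}$. A squarefree monomial ideal $I$ (one generated by squarefree monomials) is a squarefree Borel ideal (also called $1$-Borel) if for every squarefree monomial $u\in I$, every $j\in\operatorname{supp}(u)$ and every $i<j$ one has $x_i(u/x_j)\in I$, provided $x_i(u/x_j)$ is squarefree. $B_1(u)$ (the ideal, not to be confused with the block $B_1$) is the smallest squarefree Borel ideal containing $u$. A block of $u$ is a subset of $\operatorname{supp}(u)$ consisting of consecutive integers; a block is maximal if it is not properly contained in another block of $u$. $\operatorname{supp}(u)$ is uniquely the disjoint union of its maximal blocks $B_1\sqcup B_2\sqcup\cdots\sqcup B_r$ with $\max(B_i)<\min(B_{i+1})-1$ for all $i$; $B_1$, the maximal block containing $\min(\operatorname{supp}(u))$, is the first block of $u$. *)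

(* Defs.v *)
From HB Require Import structures.
From mathcomp Require Import all_boot all_order all_algebra.
From mathcomp Require Import mpoly.

Set Implicit Arguments.
Unset Strict Implicit.
Unset Printing Implicit Defensive.

Import GRing.Theory.
Local Open Scope ring_scope.

(* Ideals of {mpoly K[n]} are Prop-valued predicates, compared pointwise: the
   boolean ideals of ring_quotient would restrict to decidable ones, and that
   interface also excludes the unit ideal.  The variable x_(i+1) is 'X_i, with
   i : 'I_n, and a monomial is given by its exponent vector in 'X_{1..n}. *)

Section Ideals.
Variables (K : fieldType) (n : nat).
Implicit Types (I J P Q V : {mpoly K[n]} -> Prop) (f g : {mpoly K[n]}).

Definition is_ideal I : Prop :=
  [/\ I 0, (forall f g, I f -> I g -> I (f + g))
    & (forall f g, I g -> I (f * g))].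

Definition incl I J : Prop := forall f, I f -> J f.

Definition ideal_eq I J : Prop := forall f, I f <-> J f.

Definition strict_incl I J : Prop := incl I J /\ exists2 f, J f & ~ I f.

Definition ideal_gen (G : {mpoly K[n]} -> Prop) f : Prop :=
  forall J, is_ideal J -> incl G J -> J f.

Definition is_prime P : Prop :=
  [/\ is_ideal P, ~ P 1 & (forall f g, P (f * g) -> P f \/ P g)].

Definition minimal_prime I P : Prop :=
  [/\ is_prime P, incl I P
    & (forall Q, is_prime Q -> incl I Q -> incl Q P -> ideal_eq Q P)].

(* C 0, ..., C k is a chain of primes of length k. *)
Definition prime_chain (C : nat -> {mpoly K[n]} -> Prop) (k : nat) : Prop :=
  (forall i, (i <= k)%N -> is_prime (C i))
  /\ (forall i, (i < k)%N -> strict_incl (C i) (C i.+1)).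

Definition prime_height P (h : nat) : Prop :=
  (exists2 C, prime_chain C h & ideal_eq (C h) P)
  /\ (forall C k, prime_chain C k -> ideal_eq (C k) P -> (k <= h)%N).

(* The least height of a prime containing I; primes of infinite height (there
   are none in this ring) could not affect the minimum. *)
Definition ideal_height I (h : nat) : Prop :=
  (exists P, [/\ is_prime P, incl I P & prime_height P h])
  /\ (forall P k, is_prime P -> incl I P -> prime_height P k -> (h <= k)%N).

(* Krull dimension of K[x_1, ..., x_n] / I, whose primes are those above I. *)
Definition quot_krull_dim I (d : nat) : Prop :=
  (exists2 C, prime_chain C d & incl I (C 0%N))
  /\ (forall C k, prime_chain C k -> incl I (C 0%N) -> (k <= d)%N).

(* dim_K V / (V \cap I) = m, for a K-subspace V: b is a basis modulo I. *)
Definition quot_dim V I (m : nat) : Prop :=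
  exists b : 'I_m -> {mpoly K[n]},
    [/\ (forall i, V (b i)),
        (forall f, V f ->
           exists c : 'I_m -> K, I (f - \sum_(i < m) c i *: b i))
      & (forall c : 'I_m -> K,
           I (\sum_(i < m) c i *: b i) -> forall i, c i = 0)].

(* H(S/I, t) = m, for I homogeneous. *)
Definition hilbert_fun I (t m : nat) : Prop :=
  quot_dim (fun f => f \is t.-homog) I m.

Definition hilbert_poly I (p : {poly rat}) : Prop :=
  exists t0 : nat, forall t : nat, (t0 <= t)%N ->
    exists2 m : nat, hilbert_fun I t m & m%:R = p.[t%:R].

(* e(S/I) = e: with d = dim S/I, this is (d-1)! times the coefficient of
   degree d-1 of the Hilbert polynomial if d > 0, and dim_K S/I if d = 0. *)
Definition multiplicity I (e : nat) : Prop :=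
  exists2 d : nat, quot_krull_dim I d &
    if d is d'.+1 then
      exists2 p : {poly rat}, hilbert_poly I p & e%:R = d'`!%:R * p`_d'
    else quot_dim (fun _ => True) I e.

End Ideals.

Section Monomials.
Variable n : nat.
Implicit Types (u v : 'X_{1..n}) (A B : {set 'I_n}).

Definition squarefree u : Prop := forall i, (u i <= 1)%N.

Definition supp u : {set 'I_n} := [set i | (0 < u i)%N].

(* x_i (u / x_j), for j in supp u. *)
Definition exchange u (i j : 'I_n) : 'X_{1..n} := (u - U_(j) + U_(i))%MM.

Definition block u : pred {set 'I_n} := fun B =>
  (B \subset supp u) &&
  [forall i in B, forall k in B, forall j : 'I_n,
    (i <= j <= k)%N ==> (j \in B)].

Definition first_block u B : Prop :=
  maxset (block u) B
  /\ exists2 i, i \in B & forall j, j \in supp u -> (i <= j)%N.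

(* max(B) for the numbering of the variables from 1. *)
Definition max_index B : nat := \max_(i in B) i.+1.

End Monomials.

Section Borel.
Variables (K : fieldType) (n : nat).

(* P_A *)
Definition var_ideal (A : {set 'I_n}) : {mpoly K[n]} -> Prop :=
  ideal_gen (fun f => exists2 i, i \in A & f = 'X_i).

Definition squarefree_monomial_ideal (I : {mpoly K[n]} -> Prop) : Prop :=
  exists2 G : 'X_{1..n} -> Prop, forall m, G m -> squarefree m
    & ideal_eq I (ideal_gen (fun f => exists2 m, G m & f = 'X_[m])).

Definition squarefree_borel (I : {mpoly K[n]} -> Prop) : Prop :=
  squarefree_monomial_ideal I
  /\ forall v : 'X_{1..n}, squarefree v -> I 'X_[v] ->
     forall i j : 'I_n, j \in supp v -> (i < j)%N ->
     squarefree (exchange v i j) -> I 'X_[exchange v i j].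

(* B_1(u), the smallest squarefree Borel ideal containing u, as the
   intersection of all of them (squarefree Borel ideals are stable under
   intersection). *)
Definition borel_ideal (u : 'X_{1..n}) : {mpoly K[n]} -> Prop :=
  fun f => forall J, squarefree_borel J -> J 'X_[u] -> J f.

End Borel.

Arguments var_ideal K {n} A _ : assert.
Arguments borel_ideal K {n} u _ : assert.

(* Main.v *)
Require Import Defs.
From HB Require Import structures.
From mathcomp Require Import all_boot all_order all_algebra.
From mathcomp Require Import mpoly.
From mathcomp Require Import zify.
From Stdlib Require Import Classical.

(** Write U for supp(u), with least element a, and m for max(B_1) as numbered
    from 1: the first block is {a, ..., m - 1} for the numbering from 0, which
    is used below.

    The ideal B_1(u) is the squarefree monomial ideal of the monomials whose
    support W dominates U: for every t, W has at least as many elements as U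
    among the first t indices ([borel_idealE]). Indeed dominance is preserved
    by exchanges and by enlarging W, and conversely exchanges lead from U to a
    subset of any W that dominates it ([borel_dominated]).

    Every prime containing a squarefree monomial ideal contains P_A for some
    vertex cover A ([prime_above_cover]), and P_A has height |A|
    ([var_ideal_height]). The latter reduces, by completing chains with primes
    generated by variables, to the fact that chains of primes of
    K[x_1, ..., x_n] have length at most n ([prime_chain_le]). That fact is
    proved by counting: a chain of length k yields k algebraically independent
    polynomials, and n + 1 polynomials in n variables are algebraically
    dependent because there are too few monomials of bounded degree. So the
    minimal primes of minimal height are the P_A with A a vertex cover of
    minimal size c ([minimal_prime_cover]).

    The monomials outside the ideal are those whose support F is a face, i.e.
    the complement of a vertex cover. There are 'C(t - 1, |F| - 1) monomials of
    degree t > 0 with support F, so for n > c the Hilbert polynomial has degree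
    n - c - 1, and (n - c - 1)! times its leading coefficient is the number of
    faces of size n - c. So the multiplicity is the number of vertex covers of
    size c ([mon_multiplicity]).

    Finally, A is a vertex cover if and only if its complement does not
    dominate U. As U contains all indices from a to m - 1, none below a, and
    not m, there is no vertex cover of size at most a, and those of size a + 1
    are exactly the sets of a + 1 indices below m ([cover_small],
    [below_cover]). There are 'C(m, a + 1) = 'C(m, |B_1| - 1) of them, since
    |B_1| = m - a. *)

Set Implicit Arguments.
Unset Strict Implicit.
Unset Printing Implicit Defensive.

Import GRing.Theory.
Local Open Scope ring_scope.

(** * Ideals generated by variables *)

Section IdealTheory.
Variables (K : fieldType) (n : nat).
Implicit Types (I J P Q : {mpoly K[n]} -> Prop) (f g : {mpoly K[n]}).

Lemma ideal_gen_ideal (G : {mpoly K[n]} -> Prop) : is_ideal (ideal_gen G).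
Proof.
split=> [J [] // | f g If Ig J iJ GJ | f g Ig J iJ GJ].
- by case: (iJ) => _ addJ _; apply: addJ; [apply: If | apply: Ig].
- by case: (iJ) => _ _ mulJ; apply: mulJ; apply: Ig.
Qed.

Lemma ideal_gen_sub (G : {mpoly K[n]} -> Prop) f : G f -> ideal_gen G f.
Proof. by move=> Gf J _; apply. Qed.

Lemma is_ideal_eq I J : ideal_eq I J -> is_ideal J -> is_ideal I.
Proof.
move=> eqIJ [J0 JD JM]; split; first exact/eqIJ.
- by move=> f g /eqIJ Jf /eqIJ Jg; apply/eqIJ/JD.
- by move=> f g /eqIJ Jg; apply/eqIJ/JM.
Qed.

Lemma is_prime_ideal P : is_prime P -> is_ideal P.
Proof. by case. Qed.

Lemma is_prime_eq P Q : ideal_eq P Q -> is_prime Q -> is_prime P.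
Proof.
move=> eqPQ [iQ Q1 QM]; split; first exact: is_ideal_eq iQ.
- by move/eqPQ.
- by move=> f g /eqPQ /QM [] H; [left | right]; apply/eqPQ.
Qed.

Lemma idealZ I (c : K) f : is_ideal I -> I f -> I (c *: f).
Proof. by case=> _ _ mulI If; rewrite -mul_mpolyC; apply: mulI. Qed.

Lemma idealB I f g : is_ideal I -> I f -> I g -> I (f - g).
Proof.
move=> iI If Ig; case: (iI) => _ addI _; apply: addI => //.
by rewrite -scaleN1r; apply: idealZ.
Qed.

Lemma ideal_sum I (T : eqType) (s : seq T) (F : T -> {mpoly K[n]}) :
  is_ideal I -> {in s, forall x, I (F x)} -> I (\sum_(x <- s) F x).
Proof.
move=> [I0 ID _] IF; by rewrite big_seq; apply: (big_ind I) => //.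
Qed.

Lemma ideal_monomials I f :
  is_ideal I -> {in msupp f, forall w, I 'X_[w]} -> I f.
Proof.
move=> iI If; rewrite (mpolyE f); apply: ideal_sum => // w wf.
by apply: idealZ => //; apply: If.
Qed.

Lemma prime_prod P (T : eqType) (s : seq T) (F : T -> {mpoly K[n]}) :
  is_prime P -> P (\prod_(x <- s) F x) -> exists2 x, x \in s & P (F x).
Proof.
move=> [_ P1 PM]; elim: s => [|x s IHs]; first by rewrite big_nil => /P1.
rewrite big_cons => /PM [Px | /IHs [y ys Py]].
  by exists x; rewrite ?mem_head.
by exists y => //; rewrite inE ys orbT.
Qed.

Lemma primeX P f k : is_prime P -> P (f ^+ k) -> (0 < k)%N /\ P f.
Proof.
move=> [_ P1 PM]; elim: k => [|k IHk]; first by rewrite expr0 => /P1.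
by rewrite exprS => /PM [] // /IHk [].
Qed.

Lemma prime_monomial P (w : 'X_{1..n}) :
  is_prime P -> P 'X_[w] -> exists2 i, i \in supp w & P 'X_i.
Proof.
move=> pP; rewrite mpolyXE_id => /(prime_prod pP) [i _ /(primeX pP) [wi Pi]].
by exists i; rewrite ?inE.
Qed.

(** The set of variables lying in an ideal is not computable, hence the use of
    excluded middle. *)
Lemma set_of_Prop (Q : 'I_n -> Prop) :
  exists A : {set 'I_n}, forall i, i \in A <-> Q i.
Proof.
suff [A HA] : exists A : {set 'I_n},
    forall i, (i \in enum 'I_n) -> (i \in A <-> Q i).
  by exists A => i; apply: HA; rewrite mem_enum.
elim: (enum 'I_n) => [|j s [A HA]]; first by exists set0.
case: (classic (Q j)) => Qj.
  exists (j |: A) => i; rewrite !inE => /orP [/eqP -> | /HA].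
    by rewrite eqxx.
  by case: eqP => [-> | _] //=; split.
exists (A :\ j) => i; rewrite !inE => /orP [/eqP -> | /HA].
  by rewrite eqxx.
by case: eqP => [-> | _] //=; split.
Qed.

Lemma ideal_monomial_dvd I (w v : 'X_{1..n}) :
  is_ideal I -> I 'X_[v] -> (v <= w)%MM -> I 'X_[w].
Proof.
by move=> [_ _ IM] Iv vw; rewrite -(submK vw) mpolyXD; apply: IM.
Qed.

Lemma ideal_monomial_var I (w : 'X_{1..n}) i :
  is_ideal I -> I 'X_i -> i \in supp w -> I 'X_[w].
Proof.
move=> iI Ii; rewrite inE => wi; apply: ideal_monomial_dvd Ii _ => //.
by apply/mnm_lepP => j; rewrite mnm1E; case: eqP => [<-|].
Qed.

(** The substitution sending the variables in A to 0 and fixing the others; its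
    kernel is P_A. *)
Definition kill (A : {set 'I_n}) : n.-tuple {mpoly K[n]} :=
  [tuple if i \in A then 0 else 'X_i | i < n].

Lemma killX A i : 'X_i \mPo kill A = if i \in A then 0 else 'X_i.
Proof. by rewrite comp_mpolyXU -tnth_nth tnth_mktuple. Qed.

Lemma var_ideal_ideal (A : {set 'I_n}) : is_ideal (var_ideal K A).
Proof. exact: ideal_gen_ideal. Qed.

Lemma var_ideal_kill (A : {set 'I_n}) f : var_ideal K A f -> f \mPo kill A = 0.
Proof.
move/(_ (fun g => g \mPo kill A = 0)); apply; last first.
  by move=> _ [i iA ->]; rewrite killX iA.
split; first by rewrite comp_mpoly0.
- by move=> g h gA hA; rewrite comp_mpolyD gA hA addr0.
- by move=> g h hA; rewrite rmorphM /= hA mulr0.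
Qed.

Lemma var_idealP (A : {set 'I_n}) f : var_ideal K A f <-> f \mPo kill A = 0.
Proof.
split=> [|f0]; first exact: var_ideal_kill.
have iA := var_ideal_ideal A.
suff : var_ideal K A (f - (f \mPo kill A)) by rewrite f0 subr0.
rewrite {1}(mpolyE f) comp_mpolyEX -sumrB; apply: ideal_sum => // w _.
rewrite -scalerBr; refine (idealZ _ iA _).
case: (pickP [pred i in supp w | i \in A]) => [i /andP [/= iw iiA] | noA].
  have wA : var_ideal K A 'X_[w].
    by apply: (ideal_monomial_var iA _ iw); apply: ideal_gen_sub; exists i.
  by rewrite (var_ideal_kill wA) subr0.
suff -> : 'X_[w] \mPo kill A = 'X_[w] by rewrite subrr; case: iA.
rewrite comp_mpolyX [RHS]mpolyXE_id; apply: eq_bigr => i _.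
rewrite tnth_mktuple; have := noA i; rewrite /= inE.
by case: (w i) => [|k]; rewrite ?expr0 //= => ->.
Qed.

Lemma var_ideal_prime (A : {set 'I_n}) : is_prime (var_ideal K A).
Proof.
split; first exact: var_ideal_ideal.
- by move/var_idealP/eqP; rewrite rmorph1 oner_eq0.
- move=> f g /var_idealP/eqP; rewrite rmorphM mulf_eq0 => /orP [] /eqP H.
  + by left; apply/var_idealP.
  + by right; apply/var_idealP.
Qed.

Lemma mem_var_ideal (A : {set 'I_n}) i : var_ideal K A 'X_i <-> i \in A.
Proof.
split=> [/var_idealP | iA]; last by apply: ideal_gen_sub; exists i.
rewrite killX; case: ifP => // _ /eqP.
by rewrite -msupp_eq0 msuppX.
Qed.

Lemma var_ideal_incl I (A : {set 'I_n}) :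
  is_ideal I -> {in A, forall i, I 'X_i} -> incl (var_ideal K A) I.
Proof. by move=> iI IA f /(_ I); apply=> // _ [i /IA Ii ->]. Qed.

Lemma var_idealS (A A' : {set 'I_n}) :
  A \subset A' -> incl (var_ideal K A) (var_ideal K A').
Proof.
move=> /subsetP sAA'; apply: var_ideal_incl; first exact: var_ideal_ideal.
by move=> i /sAA' /mem_var_ideal.
Qed.

End IdealTheory.

(** * Chains of primes have length at most the number of variables *)

Section Dimension.
Variables (K : fieldType) (n : nat).
Implicit Types (C : nat -> {mpoly K[n]} -> Prop) (f g : {mpoly K[n]}).

Lemma prime_chain_shift C m :
  prime_chain C m.+1 -> prime_chain (fun i => C i.+1) m.
Proof. by case=> pC sC; split=> i Hi; [apply: pC | apply: sC]. Qed.

Lemma sum_cons_tuple (V : nmodType) m d (F : m.+1.-tuple 'I_d -> V) :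
  \sum_e F e = \sum_(j < d) \sum_(e : m.-tuple 'I_d) F (cons_tuple j e).
Proof.
rewrite pair_bigA /=.
rewrite (reindex (fun p : 'I_d * m.-tuple 'I_d => cons_tuple p.1 p.2)) //=.
exists (fun e : m.+1.-tuple 'I_d => (thead e, [tuple of behead e])).
  by move=> [j e] _ /=; congr (_, _); apply: val_inj.
by move=> e _; rewrite [RHS]tuple_eta; apply: val_inj.
Qed.

(** If f_i lies in C_(i+1) but not in C_i, then the monomials of partial degree
    less than d in the f_i are linearly independent, even modulo C_0: the
    lexicographically least monomial of a relation could be factored out one f_i
    at a time, leaving a nonzero constant in the last prime. *)
Lemma prime_chain_independent m d C (f : nat -> {mpoly K[n]}) :
  prime_chain C m ->
  (forall i, (i < m)%N -> C i.+1 (f i) /\ ~ C i (f i)) ->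
  forall c : m.-tuple 'I_d -> K,
    C 0%N (\sum_e c e *: \prod_(i < m) f i ^+ tnth e i) -> forall e, c e = 0.
Proof.
elim: m C f => [|m IHm] C f chC Cf c C0 e.
  apply/eqP/negPn/negP => ce.
  have [iC C1 _] : is_prime (C 0%N) by case: chC => H _; apply: H.
  apply: C1; suff <- : (c e)^-1 *: (c e *: 1) = 1 :> {mpoly K[n]}.
    apply: idealZ => //; move: C0; rewrite (bigD1 e) //= big_ord0 big1 ?addr0 //.
    by move=> e'; rewrite (tuple0 e') (tuple0 e) eqxx.
  by rewrite scalerA mulVf // scale1r.
pose g j := \sum_(e' : m.-tuple 'I_d)
  c (cons_tuple j e') *: \prod_(i < m) f i.+1 ^+ tnth e' i.
have {}C0 : C 0%N (\sum_(j < d) f 0%N ^+ j * g j).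
  congr (C 0%N _): C0; rewrite sum_cons_tuple; apply: eq_bigr => j _.
  rewrite mulr_sumr; apply: eq_bigr => e' _.
  rewrite -scalerAr big_ord_recl tnth0; congr (_ *: (_ * _)).
  by apply: eq_bigr => i _; rewrite tnthS.
have pC i : (i <= m.+1)%N -> is_prime (C i) by case: chC => H _; apply: H.
have [iC0 _ pC0] := pC 0%N isT; have [iC1 _ _] := pC 1%N isT.
have [C1f C0f] := Cf 0%N isT.
have inc01 : incl (C 0%N) (C 1%N) by case: chC => _ /(_ 0%N isT) [].
suff H k (j : 'I_d) : (j < k)%N -> forall e', c (cons_tuple j e') = 0.
  have -> : e = cons_tuple (thead e) [tuple of behead e].
    by rewrite [LHS]tuple_eta; apply: val_inj.
  exact: (H (thead e).+1).
elim: k j => // k IHk j; rewrite ltnS leq_eqVlt => /orP [/eqP jk|]; last exact: IHk.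
(* The coefficients of the powers of f_0 below j are known to vanish; dividing
   by f_0 ^ j, which C_0 does not contain, leaves g_j in C_1. *)
have gz (i : 'I_d) : (i < j)%N -> g i = 0.
  rewrite jk => ij; rewrite /g big1 // => e' _; rewrite IHk ?scale0r //.
apply: (IHm (fun i => C i.+1) (fun i => f i.+1)).
- exact: prime_chain_shift.
- by move=> i im; apply: Cf.
pose r := \sum_(i < d | (j < i)%N) f 0%N ^+ (i - j.+1) * g i.
have {C0}: C 0%N (f 0%N ^+ j * (g j + f 0%N * r)).
  congr (C 0%N _): C0.
  rewrite (bigID (fun i : 'I_d => (i < j)%N)) /= big1 ?add0r; last first.
    by move=> i ij; rewrite gz ?mulr0.
  rewrite (bigD1 j) ?ltnn //= mulrDr; congr (_ + _).
  rewrite mulrA -exprSr mulr_sumr.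
  apply: eq_big => [i|i]; first by rewrite -leqNgt [RHS]ltn_neqAle eq_sym andbC.
  rewrite -leqNgt => ij; rewrite mulrA -exprD subnKC // ltn_neqAle andbC eq_sym //.
case/pC0 => [Cj | /inc01 C1].
  by case: (primeX (pC 0%N isT) Cj).
rewrite -/(g j) -(addrK (f 0%N * r) (g j)).
apply: idealB => //; rewrite mulrC; case: iC1 => _ _; exact.
Qed.

(** There are (N + 1) ^ n monomials with all exponents at most N, and they span
    all polynomials of degree at most N. *)
Lemma polys_dependent (T : finType) (g : T -> {mpoly K[n]}) N :
  (forall e, {in msupp (g e), forall w, mdeg w <= N}%N) ->
  (N.+1 ^ n < #|T|)%N ->
  exists c : T -> K, \sum_e c e *: g e = 0 /\ exists e, c e != 0.
Proof.
move=> gN; pose W := {ffun 'I_n -> 'I_N.+1}.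
have <- : #|{: W}| = (N.+1 ^ n)%N by rewrite card_ffun !card_ord.
move=> TW; pose mon (w : W) : 'X_{1..n} := [multinom (w i : nat) | i < n].
pose M : 'M[K]_(#|T|, #|{: W}|) :=
  \matrix_(e, w) (g (enum_val e))@_(mon (enum_val w)).
have : kermx M != 0.
  by rewrite kermx_eq0 /row_free neq_ltn (leq_ltn_trans (rank_leq_col M) TW).
case/rowV0Pn => v /sub_kermxP vM v0.
exists (fun e => v 0 (enum_rank e)); split; last first.
  case: (pickP (fun j => v 0 j != 0)) => [j vj | vz].
    by exists (enum_val j); rewrite enum_valK.
  by case/eqP: v0; apply/rowP => j; rewrite mxE; apply/eqP; have /negbFE := vz j.
apply/mpolyP => w; rewrite mcoeff0 raddf_sum /=.
case: (boolP [forall i, w i <= N]%N) => [/forallP wN | wN].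
  have wE : w = mon [ffun i => inord (w i)].
    by apply/mnmP => i; rewrite mnmE ffunE inordK ?ltnS.
  move/rowP/(_ (enum_rank ([ffun i => inord (w i)] : W))): vM.
  rewrite !mxE => vw; rewrite -[RHS]vw (reindex (@enum_rank T)) /=; last first.
    exact: onW_bij (enum_rank_bij _).
  by apply: eq_bigr => e _; rewrite mcoeffZ mxE !enum_rankK -wE.
apply: big1 => e _; rewrite mcoeffZ.
case: (boolP (w \in msupp (g e))) => [/gN wd|]; last first.
  by rewrite -mcoeff_eq0 => /eqP ->; rewrite mulr0.
case/negP: wN; apply/forallP => i; apply: leq_trans wd.
by rewrite mdegE (bigD1 i) //= leq_addr.
Qed.

(** The degree of f is at most N; this holds for f = 0 and every N. *)
Definition deg_le f N := {in msupp f, forall w, mdeg w <= N}%N.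

Lemma deg_leM f g N M : deg_le f N -> deg_le g M -> deg_le (f * g) (N + M).
Proof.
move=> fN gM w /msuppM_le /allpairsP [[w1 w2] /= [/fN H1 /gM H2 ->]].
by rewrite mdegD leq_add.
Qed.

Lemma deg_le1 : deg_le 1 0.
Proof. by move=> w; rewrite msupp1 inE => /eqP ->; rewrite mdeg0. Qed.

Lemma deg_leX f N k : deg_le f N -> deg_le (f ^+ k) (k * N).
Proof.
move=> fN; elim: k => [|k IHk]; first exact: deg_le1.
by rewrite exprS mulSn; apply: deg_leM.
Qed.

Lemma deg_le_prod m (F : 'I_m -> {mpoly K[n]}) N :
  (forall i, deg_le (F i) N) -> deg_le (\prod_(i < m) F i) (m * N).
Proof.
move=> FN; elim: m F FN => [|m IHm] F FN; first by rewrite big_ord0; apply: deg_le1.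
by rewrite big_ord_recl mulSn; apply: deg_leM => //; apply: IHm.
Qed.

Lemma deg_leW f N M : (N <= M)%N -> deg_le f N -> deg_le f M.
Proof. by move=> NM fN w /fN /leq_trans; apply. Qed.

(** In a longer chain, the d ^ (n + 1) monomials of partial degree less than d
    in f_0, ..., f_n would be independent, but their degree is less than
    (n + 1) d D for D > 0 a bound on the degrees of the f_i, so they lie in a
    space of dimension O(d ^ n). *)
Lemma prime_chain_le C m : prime_chain C m -> (m <= n)%N.
Proof.
move=> chC; rewrite leqNgt; apply/negP => nm.
have {nm m} chC : prime_chain C n.+1.
  case: chC => pC sC; split=> i Hi.
    exact/pC/(leq_trans Hi).
  exact/sC/(leq_trans Hi).
have [f Cf] : exists f : nat -> {mpoly K[n]},
    forall i, (i < n.+1)%N -> C i.+1 (f i) /\ ~ C i (f i).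
  elim: n.+1 chC => [|m IHm] chC; first by exists (fun=> 0).
  have [|f Cf] := IHm.
    by case: chC => pC sC; split=> i Hi; [apply/pC/ltnW | apply/sC/ltnW].
  case: chC => _ /(_ m (ltnSn m)) [_ [g Cg nCg]].
  exists (fun i => if i == m then g else f i) => i.
  by rewrite ltnS leq_eqVlt; case: eqP => [-> // | _] /=; apply: Cf.
pose D := (\sum_(i < n.+1) msize (f i))%N.
have fD (i : 'I_n.+1) : deg_le (f i) D.
  move=> w /msize_mdeg_lt /ltnW /leq_trans; apply.
  by rewrite /D (bigD1 i) //= leq_addr.
(* With these choices the dimension is at most (d * L) ^ n < d ^ (n + 1). *)
pose L := (n.+1 * D).+1; pose d := (L ^ n).+1.
pose g (e : n.+1.-tuple 'I_d) := \prod_(i < n.+1) f i ^+ tnth e i.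
have gN e : deg_le (g e) (n.+1 * (d * D)).
  apply: deg_le_prod => i; apply: deg_leW (deg_leX (fD i)).
  by rewrite leq_mul2r ltnW ?orbT.
have [|c [c0 [e]]] := polys_dependent gN.
  rewrite card_tuple card_ord; apply: (@leq_ltn_trans ((d * L) ^ n)%N).
    have leX a b e : (a <= b -> a ^ e <= b ^ e)%N.
      by case: e => // e; rewrite leq_exp2r.
    by apply: leX; rewrite /L mulnS mulnCA -add1n leq_add2r.
  by rewrite expnMn expnSr ltn_pmul2l ?expn_gt0.
case/eqP; apply: (prime_chain_independent chC Cf); rewrite c0.
by case: chC => /(_ 0%N isT) [[]].
Qed.

End Dimension.

(** * Heights of the primes generated by variables *)

Section Chains.
Variables (K : fieldType) (n : nat).
Implicit Types (C : nat -> {mpoly K[n]} -> Prop) (A : {set 'I_n}).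

Lemma prime_chain_cat C1 k1 C2 k2 :
  prime_chain C1 k1 -> prime_chain C2 k2 -> incl (C1 k1) (C2 0%N) ->
  prime_chain (fun i => if (i < k1)%N then C1 i else C2 (i - k1)%N) (k1 + k2).
Proof.
move=> [p1 s1] [p2 s2] s12; split=> i Hi.
  by case: ltnP => Hk; [apply/p1/ltnW | apply: p2; lia].
case: ltnP => Hk; case: ltnP => Hk'; try lia; first exact: s1.
  have [incC [f Cf nCf]] := s1 i Hk; have -> : (i.+1 - k1)%N = 0%N by lia.
  have {}s12 : incl (C1 i.+1) (C2 0%N) by have <- : k1 = i.+1 by lia.
  by split=> [g /incC /s12 // |]; exists f => //; apply: s12.
have -> : (i.+1 - k1 = (i - k1).+1)%N by lia.
by apply: s2; lia.
Qed.

(** The chain from P_A to P_A' that adds the elements of A' outside A one by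
    one. *)
Definition var_chain A A' i : {mpoly K[n]} -> Prop :=
  var_ideal K (A :|: [set x in take i (enum (A' :\: A))]).

Lemma var_chainP A A' : prime_chain (var_chain A A') #|A' :\: A|.
Proof.
split=> i Hi; first exact: var_ideal_prime.
have x0 : 'I_n by case: (pickP (mem (A' :\: A))) Hi => [x _ //|/eq_card0 ->].
have Hi' : (i < size (enum (A' :\: A)))%N by rewrite -cardE.
pose x := nth x0 (enum (A' :\: A)) i.
have xA : x \in A' :\: A by rewrite -mem_enum mem_nth.
rewrite /var_chain (take_nth x0) // -/x; split.
  apply: var_idealS; apply: setUS; apply/subsetP => y.
  by rewrite !inE mem_rcons inE => ->; rewrite orbT.
exists 'X_x; first by apply/mem_var_ideal; rewrite !inE mem_rcons mem_head orbT.
move/mem_var_ideal; rewrite in_setU inE.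
move: xA; rewrite inE => /andP [/negPf -> _] /=.
have /(take_uniq i.+1) := enum_uniq (A' :\: A).
by rewrite (take_nth x0) // rcons_uniq => /andP [/negPf -> _].
Qed.

Lemma var_chain0 A A' : var_chain A A' 0 = var_ideal K A.
Proof.
congr (var_ideal K _); apply/setP => x.
by rewrite !inE take0 orbF.
Qed.

Lemma var_chain_last A A' :
  A \subset A' -> var_chain A A' #|A' :\: A| = var_ideal K A'.
Proof.
move=> sAA'; congr (var_ideal K _); apply/setP => x.
rewrite !inE cardE take_size mem_enum inE.
by case: (boolP (x \in A)) => [/(subsetP sAA') -> | _].
Qed.

(** Completing a chain below or above by a chain of primes generated by
    variables turns the bound on the length of all chains into bounds for chains
    starting above, or ending below, P_A. *)
Lemma chain_above_var A C k :
  prime_chain C k -> incl (var_ideal K A) (C 0%N) -> (#|A| + k <= n)%N.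
Proof.
move=> chC AC; have ch0 := var_chainP set0 A.
have {ch0} := prime_chain_cat ch0 chC.
rewrite var_chain_last ?sub0set // => /(_ AC) /prime_chain_le.
by rewrite setD0.
Qed.

Lemma chain_below_var A C k :
  prime_chain C k -> incl (C k) (var_ideal K A) -> (k <= #|A|)%N.
Proof.
move=> chC CA; have ch1 := var_chainP A setT.
have {ch1} := prime_chain_cat chC ch1.
rewrite var_chain0 => /(_ CA) /prime_chain_le.
by rewrite setTD; have := cardsC A; rewrite card_ord; lia.
Qed.

Lemma var_ideal_height A : prime_height (var_ideal K A) #|A|.
Proof.
split; last first.
  by move=> C k chC CA; apply: chain_below_var chC _ => f /CA.
exists (var_chain set0 A); first by have := var_chainP set0 A; rewrite setD0.
by have := @var_chain_last set0 A (sub0set _); rewrite setD0 => ->.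
Qed.

Lemma prime_height_unique (P Q : {mpoly K[n]} -> Prop) h k :
  ideal_eq P Q -> prime_height P h -> prime_height Q k -> h = k.
Proof.
move=> PQ [[C chC CP] Ph] [[C' chC' CQ] Qk]; apply/eqP; rewrite eqn_leq.
apply/andP; split; [apply: Qk chC _ | apply: Ph chC' _] => f.
  by split=> [/CP/PQ | /PQ/CP].
by split=> [/CQ/PQ | /PQ/CQ].
Qed.

End Chains.

(** * Squarefree monomial ideals and their vertex covers *)

(** A family of sets stable under passing to a larger set. *)
Definition up_closed (T : finType) (D : pred {set T}) :=
  forall W W' : {set T}, W \subset W' -> D W -> D W'.

Section MonomialIdeals.
Variables (K : fieldType) (n : nat) (D : pred {set 'I_n}).
Hypothesis upD : up_closed D.
Implicit Types (P Q : {mpoly K[n]} -> Prop) (f g : {mpoly K[n]}).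
Implicit Types (A W : {set 'I_n}).

(** The squarefree monomial ideal whose monomials are those with support in the
    up-closed family D; that is, D is the family of nonfaces of the associated
    simplicial complex. *)
Definition mon_ideal f := {in msupp f, forall w, D (supp w)}.

(** The squarefree monomial with support A. *)
Definition mon_set A : 'X_{1..n} := [multinom (i \in A : nat) | i < n].

Lemma supp_mon_set A : supp (mon_set A) = A.
Proof. by apply/setP => i; rewrite inE mnmE lt0b. Qed.

Lemma supp_add (v w : 'X_{1..n}) : supp (v + w)%MM = supp v :|: supp w.
Proof. by apply/setP => i; rewrite !inE mnmDE addn_gt0. Qed.

Lemma mon_ideal_ideal : is_ideal mon_ideal.
Proof.
split=> [w | f g If Ig w | f g Ig w]; first by rewrite msupp0.
  by move/msuppD_le; rewrite mem_cat => /orP [/If | /Ig].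
case/msuppM_le/allpairsP => [[v w'] /= [_ /Ig Dw ->]].
by apply: upD Dw; rewrite supp_add subsetUr.
Qed.

Lemma mon_idealX (w : 'X_{1..n}) : mon_ideal 'X_[w] <-> D (supp w).
Proof.
split=> [|Dw v]; last by rewrite msuppX inE => /eqP ->.
by apply; rewrite msuppX mem_head.
Qed.

(** A vertex cover: a set of variables that meets every member of D, which for
    an up-closed D means that its complement is not in D. *)
Definition vcover A := ~~ D (~: A).

Variable I : {mpoly K[n]} -> Prop.
Hypothesis IE : ideal_eq I mon_ideal.

Lemma incl_cover A : vcover A -> incl I (var_ideal K A).
Proof.
move=> cA f /IE If; apply: ideal_monomials => [|w /If Dw].
  exact: var_ideal_ideal.
case: (pickP [pred i in supp w | i \in A]) => [i /andP [/= iw iA] | noA].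
  by apply: ideal_monomial_var iw; [exact: var_ideal_ideal | apply/mem_var_ideal].
case/negP: cA; apply: upD Dw; apply/subsetP => i iw.
by move/negbT: (noA i); rewrite /= iw inE.
Qed.

(** The variables lying in a prime above I form a vertex cover, as a prime
    containing a squarefree monomial contains one of its variables. *)
Lemma prime_above_cover P :
  is_prime P -> incl I P ->
  exists A, [/\ vcover A, incl (var_ideal K A) P & forall i, i \in A <-> P 'X_i].
Proof.
move=> pP IP; have [A PA] := set_of_Prop (fun i => P 'X_i).
exists A; split=> //; last first.
  by apply: var_ideal_incl => [|i /PA //]; apply: is_prime_ideal.
apply/negP => DA; have /IE/IP/(prime_monomial pP) : mon_ideal 'X_[mon_set (~: A)].
  by apply/mon_idealX; rewrite supp_mon_set.
by rewrite supp_mon_set => -[i]; rewrite inE => /negP iA /PA.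
Qed.

Variable c : nat.
Hypothesis cover_ge : forall A, vcover A -> (c <= #|A|)%N.
Hypothesis cover_ex : exists2 A, vcover A & #|A| = c.

Lemma mon_ideal_height h : ideal_height I h -> h = c.
Proof.
move=> [[P [pP IP Ph]] hmin]; apply/eqP; rewrite eqn_leq; apply/andP; split.
  have [A cA <-] := cover_ex.
  apply: hmin (var_ideal_height K A); first exact: var_ideal_prime.
  exact: incl_cover.
have [A [cA AP _]] := prime_above_cover pP IP.
apply: leq_trans (cover_ge cA) _; case: Ph => _ Ph.
have chP : prime_chain (fun=> P) 0 by split.
have := prime_chain_cat (var_chainP K set0 A) chP.
rewrite var_chain_last ?sub0set // setD0 addn0 => /(_ AP) /Ph; apply => f.
by rewrite ltnn.
Qed.

Lemma minimal_prime_cover P :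
  (minimal_prime I P /\ prime_height P c) <->
  exists A, [/\ vcover A, #|A| = c & ideal_eq P (var_ideal K A)].
Proof.
split=> [[[pP IP minP] Ph] | [A [cA Ac PA]]].
  have [A [cA AP _]] := prime_above_cover pP IP.
  have PA : ideal_eq P (var_ideal K A).
    have AE := minP _ (var_ideal_prime K A) (incl_cover cA) AP.
    by move=> f; split=> /AE.
  exists A; split=> //.
  exact: prime_height_unique (fun f => iff_sym (PA f)) (var_ideal_height K A) Ph.
split; last first.
  rewrite -Ac; have [[C chC CA] hA] := var_ideal_height K A; split.
    by exists C => // f; split=> [/CA/PA | /PA/CA].
  by move=> C' k chC' C'P; apply: hA chC' _ => f; split=> [/C'P/PA | /PA/C'P].
split; first exact: is_prime_eq PA (var_ideal_prime K A).
  by move=> f /(incl_cover cA) /PA.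
move=> Q pQ IQ QP f; split=> [/QP // | /PA Af].
have [A' [cA' A'Q A'E]] := prime_above_cover pQ IQ.
apply: A'Q; suff -> : A' = A by [].
apply/eqP; rewrite eqEcard Ac cover_ge // andbT; apply/subsetP => i /A'E /QP /PA.
by move/mem_var_ideal.
Qed.

Lemma mon_krull_dim : quot_krull_dim I (n - c).
Proof.
split=> [|C k chC IC].
  have [A cA Ac] := cover_ex; exists (var_chain A setT).
    have := var_chainP K A setT; rewrite setTD.
    suff -> : (n - c = #|~: A|)%N by [].
    by have := cardsC A; rewrite card_ord; lia.
  by rewrite var_chain0; apply: incl_cover.
have pC : is_prime (C 0%N) by case: chC => H _; apply: H.
have [A [cA AC _]] := prime_above_cover pC IC.
by have := chain_above_var chC AC; have := cover_ge cA; lia.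
Qed.

End MonomialIdeals.

(** * Counting monomials with a prescribed support *)

Section Counting.
Variable n : nat.
Implicit Types (F : {set 'I_n}).

Lemma supp_eq0 (w : 'X_{1..n}) : supp w = set0 -> w = 0%MM.
Proof.
move/setP => w0; apply/mnmP => i; rewrite mnm0E; apply/eqP.
by rewrite -leqn0 leqNgt; have := w0 i; rewrite !inE => ->.
Qed.

(** The number of monomials of degree t with support exactly F, that is of
    compositions of t into #|F| positive parts. *)
Definition nb_support t F : nat :=
  if F == set0 then (t == 0)%N : nat else
  if t is t'.+1 then 'C(t', #|F|.-1) else 0%N.

(** Dividing by x_i a monomial of degree t + 1 with support F leaves a monomial
    of degree t with support F or F :\ i. *)
Lemma nb_supportS t F i : i \in F ->
  nb_support t.+1 F = (nb_support t F + nb_support t (F :\ i))%N.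
Proof.
move=> iF; have F0 : F != set0 by apply/set0Pn; exists i.
have [k Fk] : exists k, #|F| = k.+1 by exists #|F|.-1; rewrite (cardsD1 i) iF.
have Fik : #|F :\ i| = k by have := cardsD1 i F; rewrite iF Fk => -[].
rewrite /nb_support (negPf F0) -cards_eq0 Fk Fik /=.
case: t => [|t] /=; first by rewrite bin0n add0n; case: (k).
by case: k {Fk Fik} => [|k] /=; rewrite ?bin0 ?addn0 // binS.
Qed.

Lemma support_monomials t F : exists s : seq 'X_{1..n},
  [/\ uniq s, forall w, (w \in s) = (mdeg w == t) && (supp w == F)
    & size s = nb_support t F].
Proof.
elim: t F => [|t IHt] F.
  have supp0 : supp (0%MM : 'X_{1..n}) = set0.
    by apply/setP => i; rewrite !inE mnm0E.
  exists (if F == set0 then [:: 0%MM] else [::]); rewrite /nb_support eqxx.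
  case: (eqVneq F set0) => [->|F0]; split=> // w; rewrite mdeg_eq0 ?inE.
    by case: eqP => [->|]; rewrite // supp0 eqxx.
  by case: eqP => [->|]; rewrite // supp0 eq_sym (negPf F0).
case: (eqVneq F set0) => [->|/set0Pn [i iF]].
  exists [::]; rewrite /nb_support eqxx; split=> // w; rewrite in_nil.
  apply/esym/negP => /andP [/eqP wt /eqP w0].
  by move: wt; rewrite (supp_eq0 w0) mdeg0.
have [s1 [u1 m1 z1]] := IHt F; have [s2 [u2 m2 z2]] := IHt (F :\ i).
exists [seq (w + U_(i))%MM | w <- s1 ++ s2]; split.
- rewrite map_inj_uniq; last exact: addIm.
  rewrite cat_uniq u1 u2 andbT; apply/hasPn => w.
  rewrite m2 m1 => /andP [_ /eqP ->].
  by apply/negP => /andP [_ /eqP/setP/(_ i)]; rewrite !inE iF eqxx.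
- move=> w; apply/mapP/idP => [[v + ->]|/andP [/eqP wt /eqP wF]].
    have sU : supp U_(i)%MM = [set i].
      by apply/setP => j; rewrite !inE mnm1E eq_sym lt0b.
    rewrite mem_cat m1 m2 mdegD mdeg1 addn1 eqSS supp_add sU -andb_orr.
    case/andP => -> /orP [] /eqP -> /=.
      by rewrite setUC (setUidPr _) ?sub1set.
    by rewrite setUC setD1K.
  have wi : (U_(i) <= w)%MM.
    apply/mnm_lepP => j; rewrite mnm1E; case: eqP => [<-|] //.
    by move: iF; rewrite -wF inE.
  exists (w - U_(i))%MM; last by rewrite submK.
  rewrite mem_cat m1 m2 -andb_orr; apply/andP; split.
    by rewrite -(eqn_add2r 1) -{1}(mdeg1 i) -mdegD submK // wt addn1.
  case: (boolP (w i == 1)%N) => [/eqP wi1|wi1]; apply/orP; [right | left].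
    apply/eqP/setP => j; rewrite -wF !inE mnmBE mnm1E eq_sym.
    by case: eqP => [->|]; rewrite ?wi1 ?subn0.
  apply/eqP/setP => j; rewrite -wF !inE mnmBE mnm1E eq_sym.
  case: eqP => [->|]; rewrite ?subn0 //.
  by move: iF; rewrite -wF inE; lia.
- by rewrite size_map size_cat z1 z2 (nb_supportS _ iF).
Qed.

Lemma supports_monomials t (Fs : seq {set 'I_n}) : uniq Fs ->
  exists s : seq 'X_{1..n},
    [/\ uniq s, forall w, (w \in s) = (mdeg w == t) && (supp w \in Fs)
      & size s = (\sum_(F <- Fs) nb_support t F)%N].
Proof.
elim: Fs => [_|F Fs IHF /= /andP [FFs /IHF [s1 [u1 m1 z1]]]].
  by exists [::]; rewrite big_nil; split=> // w; rewrite !in_nil andbF.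
have [s2 [u2 m2 z2]] := support_monomials t F.
exists (s2 ++ s1); split; last by rewrite size_cat big_cons z1 z2.
  rewrite cat_uniq u1 u2 andbT; apply/hasPn => w; rewrite m1 m2 => /andP [_ wF].
  by apply/negP => /andP [_ /eqP wE]; case/negP: FFs; rewrite -wE.
by move=> w; rewrite mem_cat m1 m2 inE andb_orr.
Qed.

(** The polynomial of degree k whose value at t + 1 is 'C(t, k). *)
Definition bin_poly k : {poly rat} :=
  (k`!%:R)^-1 *: \prod_(i < k) ('X - (i.+1)%:R%:P).

Lemma fact_neq0 k : k`!%:R != 0 :> rat.
Proof. by rewrite Num.Theory.pnatr_eq0 -lt0n fact_gt0. Qed.

Lemma horner_bin_poly k t : (bin_poly k).[t.+1%:R] = 'C(t, k)%:R.
Proof.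
rewrite hornerZ; apply: (mulfI (fact_neq0 k)).
rewrite mulVKf ?fact_neq0 //; elim: k => [|k IHk].
  by rewrite big_ord0 hornerC bin0 mulr1.
rewrite big_ord_recr /= hornerM IHk hornerXsubC factS mulnC !natrM -!mulrA.
congr (_ * _); rewrite -natrM mul_bin_left mulrC.
case: (leqP k t) => [kt | tk]; first by rewrite -natrB ?ltnS // subSS natrM.
by rewrite bin_small // muln0 mulr0.
Qed.

Lemma size_bin_poly k : (size (bin_poly k) <= k.+1)%N.
Proof.
apply: leq_trans (size_scale_leq _ _) _.
by rewrite size_prod_XsubC /index_enum -enumT size_enum_ord.
Qed.

Lemma lead_bin_poly k : (bin_poly k)`_k = (k`!%:R)^-1.
Proof.
rewrite coefZ.
have /monicP : \prod_(i < k) ('X - (i.+1)%:R%:P : {poly rat}) \is monic.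
  exact: monic_prod_XsubC.
rewrite lead_coefE size_prod_XsubC /index_enum -enumT size_enum_ord => ->.
by rewrite mulr1.
Qed.

End Counting.

(** * The Hilbert polynomial of a squarefree monomial ideal *)

Section Multiplicity.
Variables (K : fieldType) (n : nat) (D : pred {set 'I_n}).
Hypothesis upD : up_closed D.
Variable I : {mpoly K[n]} -> Prop.
Hypothesis IE : ideal_eq I (mon_ideal D).

(** The monomials outside I form a basis of the quotient, also inside any
    subspace V spanned by monomials. *)
Lemma mon_quot_dim (V : {mpoly K[n]} -> Prop) (q : pred 'X_{1..n}) s :
  (forall f, V f <-> {in msupp f, forall w, q w}) ->
  uniq s -> (forall w, (w \in s) = q w && ~~ D (supp w)) ->
  quot_dim V I (size s).
Proof.
move=> VE us ms; pose w i := nth 0%MM s i.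
have sw (i : 'I_(size s)) : w i \in s by rewrite mem_nth.
have coefs (c : 'I_(size s) -> K) (i : 'I_(size s)) :
    (\sum_i c i *: 'X_[w i])@_(w i) = c i.
  rewrite raddf_sum (bigD1 i) //= mcoeffZ mcoeffX eqxx mulr1 big1 ?addr0 //.
  move=> j ji; rewrite mcoeffZ mcoeffX nth_uniq //.
  by rewrite (inj_eq val_inj) (negPf ji) mulr0.
exists (fun i => 'X_[w i]); split=> [i | f /VE Vf | c /IE Ic i].
- apply/VE => v; rewrite msuppX inE => /eqP ->.
  by have := sw i; rewrite ms => /andP [].
- exists (fun i => f@_(w i)); apply/IE => v vf.
  apply/negPn/negP => Dv; have qv : q v.
    move/msuppB_le: (vf); rewrite mem_cat => /orP [/Vf //|].
    move/msupp_sum_le => /flatten_mapP [i _] /msuppZ_le.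
    rewrite msuppX inE => /eqP ->.
    by have := sw i; rewrite ms => /andP [].
  have vs : v \in s by rewrite ms qv.
  have iv : (index v s < size s)%N by rewrite index_mem.
  move: vf; rewrite mcoeff_msupp mcoeffB.
  have -> : v = w (Ordinal iv) by rewrite /w nth_index.
  by rewrite (coefs (fun i => f@_(w i))) subrr eqxx.
- apply/eqP/negPn/negP => ci; have := sw i; rewrite ms => /andP [_ /negP []].
  by apply: Ic; rewrite mcoeff_msupp coefs.
Qed.

Variable c : nat.
Hypothesis cover_ge : forall A, vcover D A -> (c <= #|A|)%N.
Hypothesis cover_ex : exists2 A, vcover D A & #|A| = c.

(** The faces, i.e. the sets outside D, are the complements of vertex covers. *)
Lemma face_le F : ~~ D F -> (#|F| <= n - c)%N.
Proof.
move=> DF; have : vcover D (~: F) by rewrite /vcover setCK.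
by move/cover_ge; have := cardsC F; rewrite card_ord; lia.
Qed.

(** The Hilbert polynomial is the sum of bin_poly (#|F| - 1) over the nonempty
    faces F, so only the faces of the maximal size n - c, the complements of the
    vertex covers of size c, contribute to its leading coefficient. *)
Lemma mon_multiplicity :
  multiplicity I #|[set A | vcover D A & #|A| == c]|.
Proof.
exists (n - c)%N; first exact: (mon_krull_dim upD IE).
have cn : (c <= n)%N.
  by case: cover_ex => A _ <-; rewrite -[X in (_ <= X)%N](card_ord n) max_card.
case nc : (n - c)%N => [|d].
  (* In dimension 0 the only face is empty, and the quotient has basis 1. *)
  have {nc} nc : c = n by lia.
  have -> : [set A | vcover D A & #|A| == c] = [set setT].
    have cT (A : {set 'I_n}) : (#|A| == c) = (A == setT).
      by have := max_card A; rewrite eqEcard subsetT cardsT !card_ord; lia.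
    apply/setP => A; rewrite !inE cT; case: eqP => [->|]; rewrite ?andbF ?andbT //.
    by case: cover_ex => A' cA' /eqP; rewrite cT => /eqP <-.
  rewrite cards1; apply: (mon_quot_dim (q := predT) (s := [:: 0%MM])) => // w.
  rewrite inE /=.
  apply/eqP/idP => [->|/face_le].
    have [A' cA' A'c] := cover_ex; apply/negP => D0; case/negP: cA'.
    by apply: upD D0; apply/subsetP => i; rewrite !inE mnm0E.
  by rewrite nc subnn leqn0 cards_eq0 => /eqP /supp_eq0.
pose Fs := [seq F <- enum {set 'I_n} | ~~ D F & F != set0].
have memFs F : F \in Fs -> ~~ D F /\ F != set0.
  by rewrite mem_filter => /andP [/andP []].
exists (\sum_(F <- Fs) bin_poly #|F|.-1).
  (* In degree 0 the empty face contributes a monomial, so t starts at 1. *)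
  exists 1%N => -[//|t] _.
  have uFs : uniq [seq F <- enum {set 'I_n} | ~~ D F].
    by rewrite filter_uniq // enum_uniq.
  have [s [us ms zs]] := supports_monomials t.+1 uFs.
  exists (size s).
    apply: (mon_quot_dim (q := fun w => mdeg w == t.+1)) => // [f|w].
      split=> [/dhomogP H w wf | H]; first by rewrite H.
      by apply/dhomogP => w /H /eqP.
    by rewrite ms mem_filter mem_enum andbT.
  rewrite zs natr_sum horner_sum big_filter [RHS]big_filter.
  rewrite [LHS](bigID (fun F => F != set0)) /= [X in _ + X]big1 ?addr0.
    apply: eq_bigr => F /andP [_ F0].
    by rewrite horner_bin_poly /nb_support (negPf F0).
  by move=> F /andP [_ /negPn F0]; rewrite /nb_support F0.
have -> : #|[set A | vcover D A & #|A| == c]| =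
    count (fun F : {set 'I_n} => #|F| == d.+1) Fs.
  rewrite count_filter -sum1_count big_enum_cond -sum1_card.
  rewrite (reindex_inj (inv_inj (@setCK 'I_n))) /=; apply: eq_bigl => F.
  rewrite !inE /vcover -cards_eq0 andbC.
  have := cardsC F; rewrite card_ord => HF.
  have -> : (#|F| == c) = (#|~: F| == d.+1) by lia.
  by case: eqP => // ->; rewrite andbT.
rewrite coef_sum -sum1_count natr_sum mulr_sumr big_mkcond /=.
apply: eq_big_seq => F /memFs [/face_le + F0]; rewrite nc => Fd.
have [k Fk] : exists k, #|F| = k.+1.
  by exists #|F|.-1; rewrite prednK // card_gt0.
rewrite Fk /=; case: eqP => [[->]|kd].
  by rewrite lead_bin_poly mulfV ?fact_neq0.
rewrite nth_default ?mulr0 //; apply: leq_trans (size_bin_poly _) _; lia.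
Qed.

End Multiplicity.

(** * The dominance order on supports *)

Section Dominance.
Variable n : nat.
Implicit Types (U W A : {set 'I_n}).

(** The number of elements of W among the first t indices. *)
Definition count_below W (t : nat) : nat := #|[set i in W | (i < t)%N]|.

(** W dominates U: for k up to #|U|, the k-th smallest element of W exists and
    is at most the k-th smallest element of U. *)
Definition dominated U : pred {set 'I_n} :=
  fun W => [forall t : 'I_n.+1, count_below U t <= count_below W t]%N.

Lemma dominatedP U W :
  reflect (forall t, (count_below U t <= count_below W t)%N) (dominated U W).
Proof.
apply: (iffP forallP) => [H t | H t]; last exact: H.
have capE X : count_below X t = count_below X (minn t n).
  apply: eq_card => i; rewrite !inE leq_min ltn_ord andbT //.
have tn : (minn t n < n.+1)%N by lia.
by rewrite !capE; apply: (H (Ordinal tn)).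
Qed.

Lemma count_belowS W W' t :
  W \subset W' -> (count_below W t <= count_below W' t)%N.
Proof.
move=> /subsetP sW; apply/subset_leq_card/subsetP => i.
by rewrite !inE => /andP [/sW -> ->].
Qed.

Lemma dominated_up U : up_closed (dominated U).
Proof.
move=> W W' sW /dominatedP UW; apply/dominatedP => t.
exact: leq_trans (UW t) (count_belowS t sW).
Qed.

Lemma card_below t : (t <= n)%N -> #|[set i : 'I_n | (i < t)%N]| = t.
Proof.
move=> tn; rewrite -sum1_card; under eq_bigl do rewrite inE.
by rewrite (big_ord_narrow tn) sum1_card card_ord.
Qed.

Lemma count_belowC A t : (t <= n)%N ->
  (count_below A t + count_below (~: A) t)%N = t.
Proof.
move=> tn; rewrite -[RHS](card_below tn) -(cardsID A [set i : 'I_n | (i < t)%N]).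
by congr (_ + _)%N; apply: eq_card => i; rewrite !inE andbC.
Qed.

Lemma count_below_exchange W (i j : 'I_n) t :
  i \notin W -> j \in W ->
  (count_below (i |: (W :\ j)) t + (j < t) = count_below W t + (i < t))%N.
Proof.
move=> iW jW; rewrite /count_below.
have ij : i != j by apply: contraNneq iW => ->.
have -> : [set k in i |: (W :\ j) | (k < t)%N] =
    if (i < t)%N then i |: ([set k in W | (k < t)%N] :\ j)
    else [set k in W | (k < t)%N] :\ j.
  apply/setP => k; rewrite fun_if !inE; case: ifP => it; rewrite !inE.
    by case: eqP => [-> | _] //=; rewrite ?it ?andbA.
  case: eqP => [-> | _] //=; rewrite ?it ?andbF ?andbA //.
have := cardsD1 j [set k in W | (k < t)%N]; rewrite inE jW /= => ->.
case: ifP => _; last by rewrite addnC addn0.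
by rewrite cardsU1 !inE (negPf iW) andbF /=; rewrite addnC [(1 + _)%N]addnC addnA.
Qed.

End Dominance.

(** * The principal squarefree Borel ideal *)

Section Borel.
Variables (K : fieldType) (n : nat).
Implicit Types (u v w : 'X_{1..n}) (A U : {set 'I_n}).

Lemma squarefree_mon_set A : squarefree (mon_set A : 'X_{1..n}).
Proof. by move=> i; rewrite mnmE leq_b1. Qed.

Lemma mon_set_le A w : A \subset supp w -> (mon_set A <= w)%MM.
Proof.
move=> /subsetP Aw; apply/mnm_lepP => i; rewrite mnmE.
by case: (boolP (i \in A)) => // /Aw; rewrite inE.
Qed.

Lemma squarefree_mon_set_supp u : squarefree u -> u = mon_set (supp u).
Proof.
move=> sq; apply/mnmP => i; rewrite mnmE inE.
by have := sq i; case: (u i) => [|[]].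
Qed.

Lemma exchange_mon_set A (i j : 'I_n) : i \notin A -> j \in A ->
  exchange (mon_set A) i j = mon_set (i |: (A :\ j)).
Proof.
move=> iA jA; have ij : i != j by apply: contraNneq iA => ->.
apply/mnmP => k; rewrite mnmDE mnmBE !mnm1E !mnmE !inE.
rewrite (eq_sym j k) (eq_sym i k).
case: (eqVneq k i) => [->|_]; first by rewrite (negPf iA) (negPf ij).
by case: eqP => [->|]; rewrite ?jA //= subn0 addn0.
Qed.

Lemma mon_ideal_squarefree (D : pred {set 'I_n}) :
  up_closed D -> squarefree_monomial_ideal (mon_ideal D : {mpoly K[n]} -> Prop).
Proof.
move=> upD; exists (fun m => squarefree m /\ D (supp m)); first by move=> m [].
move=> f; split=> [Df J iJ GJ | ]; last first.
  move/(_ (mon_ideal D)); apply; first exact: mon_ideal_ideal.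
  by move=> _ [m [_ Dm] ->]; apply/mon_idealX.
apply: ideal_monomials => // w /Df Dw.
apply: (@ideal_monomial_dvd _ _ _ _ (mon_set (supp w))) => //; last first.
  exact: mon_set_le.
apply: GJ; exists (mon_set (supp w)) => //; split; first exact: squarefree_mon_set.
by rewrite supp_mon_set.
Qed.

Lemma mon_ideal_borel U :
  squarefree_borel (mon_ideal (dominated U) : {mpoly K[n]} -> Prop).
Proof.
split; first exact/mon_ideal_squarefree/dominated_up.
move=> v /squarefree_mon_set_supp -> /mon_idealX; set A := supp v.
rewrite supp_mon_set => UA i j jA ij sq.
have iA : i \notin A.
  have := sq i; rewrite mnmDE mnmBE !mnm1E mnmE eqxx.
  by case: (i \in A) => //=; case: eqP ij => [->|]; rewrite ?ltnn.
apply/mon_idealX; rewrite exchange_mon_set // supp_mon_set.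
apply/dominatedP => t; move/dominatedP/(_ t): UA.
by have := count_below_exchange t iA jA; lia.
Qed.

(** If U is not contained in the support of w, let j be the least element of U
    outside it. By dominance supp w has an element i < j outside U, and the
    exchange replacing j by i brings U closer to supp w while keeping it
    dominated, since U has fewer elements than supp w among the first t indices
    whenever i < t <= j. *)
Lemma borel_dominated (J : {mpoly K[n]} -> Prop) U w :
  squarefree_borel J -> J 'X_[mon_set U] -> dominated U (supp w) -> J 'X_[w].
Proof.
case=> -[G _ JG] bJ.
have iJ : is_ideal J := is_ideal_eq JG (ideal_gen_ideal _).
have [k] := ubnP #|U :\: supp w|; elim: k U => // k IHk U Uk JU /dominatedP domU.
case: (set_0Vmem (U :\: supp w)) => [/eqP|[j0 Uj0]].
  by rewrite setD_eq0 => /mon_set_le; apply: ideal_monomial_dvd.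
have [j Uj minj] : exists2 j, j \in U :\: supp w &
    forall l, l \in U :\: supp w -> (j <= l)%N.
  case: (@arg_minnP _ j0 (mem (U :\: supp w)) (fun i : 'I_n => i : nat) Uj0).
  by move=> j Uj minj; exists j.
move: (Uj); rewrite inE => /andP [jw jU].
have sUw (l : 'I_n) : l \in U -> (l < j)%N -> l \in supp w.
  move=> lU; apply: contraTT => lw; rewrite -leqNgt.
  by apply: minj; rewrite inE lw.
have [i /andP [/= iw iU] ij] : exists2 i : 'I_n,
    (i \in supp w) && (i \notin U) & (i < j)%N.
  case: (pickP [pred i : 'I_n | (i \in supp w) && (i \notin U) & (i < j)%N]).
    by move=> i /andP [? ?]; exists i.
  move=> noi; have := domU j.+1; rewrite leqNgt => /negP [].
  apply/proper_card/properP; split.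
    apply/subsetP => l; rewrite !inE => /andP [lw lj].
    have lj' : (l < j)%N.
      rewrite ltn_neqAle -ltnS lj andbT; apply: contraNneq jw => /val_inj <-.
      by rewrite inE.
    rewrite lj andbT; have /= := noi l.
    by rewrite inE lw lj' andbT; case: (l \in U).
  by exists j; rewrite in_set ?jU ?ltnSn // (negPf jw).
apply: (IHk (i |: (U :\ j))).
- apply: leq_ltn_trans (_ : _ <= #|(U :\: supp w) :\ j|)%N _.
    apply/subset_leq_card/subsetP => l; rewrite !inE.
    case/andP => lw /orP [/eqP li|/andP [-> ->]]; last by rewrite lw.
    by case/negP: lw; move: iw; rewrite inE li.
  by move: Uk; rewrite (cardsD1 j) Uj.
- rewrite -exchange_mon_set //; apply: bJ => //.
  + exact: squarefree_mon_set.
  + by rewrite supp_mon_set.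
  + by rewrite exchange_mon_set //; apply: squarefree_mon_set.
apply/dominatedP => t; have := count_below_exchange t iU jU.
case: (leqP t i) => [ti | it].
  by rewrite ltnNge (ltnW (leq_ltn_trans ti ij)) !addn0 => ->.
case: (ltnP j t) => [_ | tj]; first by rewrite !addn1 => -[->].
rewrite addn0 addn1 => ->.
apply/proper_card/properP; split.
  apply/subsetP => l; rewrite inE => /andP [lU lt]; rewrite inE lt andbT.
  exact: sUw (leq_trans lt tj).
by exists i; rewrite in_set ?iw ?(negPf iU) ?it.
Qed.

Lemma borel_idealE u :
  squarefree u -> ideal_eq (borel_ideal K u) (mon_ideal (dominated (supp u))).
Proof.
move=> sq f; split=> [|Df J bJ Ju].
  move/(_ (mon_ideal (dominated (supp u)))); apply; first exact: mon_ideal_borel.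
  by apply/mon_idealX/dominatedP.
have iJ : is_ideal J.
  by case: bJ => -[G _ JG] _; apply: is_ideal_eq JG (ideal_gen_ideal _).
apply: ideal_monomials => // w /Df; apply: borel_dominated => //.
by rewrite -squarefree_mon_set_supp.
Qed.

End Borel.

(** * Vertex covers and the first block *)

Section FirstBlock.
Variable n : nat.
Implicit Types (u : 'X_{1..n}) (B A : {set 'I_n}).

(** The first block consists of the indices from a to m - 1, numbered from 0, so
    that m is the maximum of the block for the numbering from 1; the index m, if
    any, is not in the support, by maximality. *)
Lemma first_blockP u B : first_block u B ->
  exists a : nat, let m := max_index B in
  [/\ (a < m <= n)%N,
      forall j : 'I_n, (a <= j < m)%N -> j \in supp u,
      forall j : 'I_n, j \in supp u -> (a <= j)%N,
      forall j : 'I_n, j \in supp u -> j != m :> nat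
    & #|B| = (m - a)%N].
Proof.
case=> /maxsetP [/andP [/subsetP Bu /'forall_implyP convB] maxB] [i iB imin].
set m := max_index B.
have Bm (j : 'I_n) : j \in B -> (j < m)%N.
  by move=> jB; rewrite /m /max_index (bigD1 j) //= leq_max leqnn.
have [l lB ml] : exists2 l : 'I_n, l \in B & m = l.+1.
  rewrite /m /max_index (bigmax_eq_arg _ iB).
  by case: arg_maxnP => // l lB _; exists l.
have BE (j : 'I_n) : (j \in B) = (i <= j < m)%N.
  apply/idP/idP => [jB | /andP [ij jm]].
    by rewrite (imin j) ?Bm //; apply: Bu.
  have /'forall_implyP/(_ l lB)/forallP/(_ j) := convB i iB.
  by rewrite ij -ltnS -ml jm.
exists i; split=> //.
- by rewrite Bm //= ml.
- by move=> j; rewrite -BE => /Bu.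
- move=> j ju; apply/eqP => jm.
  have jB : j \in B; last by have := Bm _ jB; rewrite jm ltnn.
  have <- : j |: B = B; last by rewrite setU11.
  apply: maxB; last exact: subsetUr.
  have jBE (k : 'I_n) : (k \in j |: B) = (i <= k <= m)%N.
    rewrite !inE BE -val_eqE /= jm; have := imin j ju; lia.
  apply/andP; split.
    by apply/subsetP => k; rewrite inE => /orP [/set1P -> //|/Bu].
  apply/'forall_implyP => x; rewrite jBE => /andP [xi xm].
  apply/'forall_implyP => y; rewrite jBE => /andP [yi ym].
  by apply/forallP => k; apply/implyP => /andP [xk ky]; rewrite jBE; lia.
- have mn : (m <= n)%N by rewrite ml.
  have <- : [set k : 'I_n | (k < m)%N] :\: [set k : 'I_n | (k < i)%N] = B.
    by apply/setP => j; rewrite BE !inE -leqNgt.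
  rewrite -[in RHS](card_below mn) -(cardsID [set k : 'I_n | (k < i)%N]).
  have -> : [set k : 'I_n | (k < m)%N] :&: [set k : 'I_n | (k < i)%N] =
      [set k : 'I_n | (k < i)%N].
    by apply/setP => k; rewrite !inE; have := Bm _ iB; lia.
  by rewrite (card_below (ltnW (ltn_ord i))) addKn.
Qed.

Variables (u : 'X_{1..n}) (a m : nat).
Hypothesis amn : (a < m <= n)%N.
Hypothesis block_supp : forall j : 'I_n, (a <= j < m)%N -> j \in supp u.
Hypothesis supp_ge : forall j : 'I_n, j \in supp u -> (a <= j)%N.
Hypothesis supp_neq : forall j : 'I_n, j \in supp u -> j != m :> nat.

Let D := dominated (supp u).

(** The first t indices. *)
Definition below_set t : {set 'I_n} := [set i : 'I_n | (i < t)%N].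

(** Beyond m the support misses the indices below a and the index m. *)
Lemma count_below_supp t : (m < t)%N -> (t <= n)%N ->
  (count_below (supp u) t + a.+1 <= t)%N.
Proof.
move=> mt tn; have mn : (m < n)%N by exact: leq_trans mt tn.
have an : (a <= n)%N by lia.
rewrite -[X in (_ <= X)%N](card_below tn).
rewrite -(cardsID (Ordinal mn |: below_set a) [set i : 'I_n | (i < t)%N]) addnC.
apply: leq_add.
  have -> : [set i : 'I_n | (i < t)%N] :&: (Ordinal mn |: below_set a)
      = Ordinal mn |: below_set a.
    by apply/setP => i; rewrite !inE -val_eqE /=; lia.
  by rewrite cardsU1 (card_below an) inE /= -leqNgt (_ : (a <= m)%N) //; lia.
apply/subset_leq_card/subsetP => i; rewrite inE => /andP [iu it].
by rewrite !inE it andbT -val_eqE /= negb_or supp_neq // -leqNgt supp_ge.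
Qed.

Lemma count_below_eq0 t : (t <= a)%N -> count_below (supp u) t = 0%N.
Proof.
move=> ta; apply/eqP; rewrite cards_eq0 -subset0; apply/subsetP => i.
by rewrite inE => /andP [/supp_ge]; lia.
Qed.

Lemma count_below_block t : (a <= t <= m)%N ->
  (count_below (supp u) t + a)%N = t.
Proof.
move=> /andP [ta tm]; have tn : (t <= n)%N by lia.
have an : (a <= n)%N by lia.
rewrite -[RHS](card_below tn).
rewrite -(cardsID (below_set a) [set i : 'I_n | (i < t)%N]) addnC.
have -> : [set i : 'I_n | (i < t)%N] :&: below_set a = below_set a.
  by apply/setP => i; rewrite !inE; lia.
rewrite (card_below an); congr (_ + _)%N; apply: eq_card => i.
rewrite in_set in_setD !in_set; case: (leqP a i) => [ai|ia] /=.
  case: (ltnP i t) => it; rewrite ?andbF ?andbT //.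
  by have := @block_supp i; rewrite in_set ai (leq_trans it tm) => ->.
by have := @supp_ge i; rewrite in_set; lia.
Qed.

Lemma count_below_card A t : (count_below A t <= #|A|)%N.
Proof. by apply/subset_leq_card/subsetP => i; rewrite inE => /andP []. Qed.

(** If the complement of A fails to dominate the support of u at t, then t is at
    most m, and A has more than a elements below t. *)
Lemma cover_small A : vcover D A -> (#|A| <= a.+1)%N ->
  #|A| = a.+1 /\ A \subset below_set m.
Proof.
move=> /forallPn [[t /= tn]]; rewrite -ltnNge => lt Aa; rewrite ltnS in tn.
have cA := count_belowC A tn; have At := count_below_card A t.
have Ata := leq_trans At Aa.
case: (leqP t a) => [/count_below_eq0 u0 | a_t]; first by rewrite u0 in lt.
case: (leqP t m) => [tm | m_t]; last first.
  by exfalso; have := count_below_supp m_t tn; lia.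
have /count_below_block ct : (a <= t <= m)%N by rewrite ltnW.
have aA : (a.+1 <= count_below A t)%N by lia.
have Ac := leq_trans Aa aA.
split; first by apply/eqP; rewrite eqn_leq Aa (leq_trans aA At).
have /eqP <- : [set i in A | (i < t)%N] == A.
  rewrite eqEcard Ac andbT.
  by apply/subsetP => i; rewrite inE => /andP [].
by apply/subsetP => i; rewrite !inE => /andP [_]; lia.
Qed.

(** The complement of A has m - a - 1 elements below m, where the support of u
    has m - a. *)
Lemma below_cover A : #|A| = a.+1 -> A \subset below_set m -> vcover D A.
Proof.
move=> Aa Am; apply/negP => /dominatedP /(_ m).
have mn : (m <= n)%N by lia.
have := count_belowC A mn; have /count_below_block : (a <= m <= m)%N by lia.
have -> : count_below A m = a.+1.
  rewrite -Aa; apply: eq_card => i; rewrite in_set.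
  by case: (boolP (i \in A)) => // /(subsetP Am); rewrite inE => ->.
lia.
Qed.

Lemma cover_ge A : vcover D A -> (a.+1 <= #|A|)%N.
Proof.
move=> cA; rewrite ltnNge; apply/negP => Aa.
by have [AE _] := cover_small cA (leqW Aa); rewrite AE ltnn in Aa.
Qed.

Lemma cover_cardE A :
  (vcover D A && (#|A| == a.+1)) = (A \subset below_set m) && (#|A| == a.+1).
Proof.
case: eqP => [Aa|]; rewrite ?andbF ?andbT //.
apply/idP/idP => [cA|]; last exact: below_cover.
by have [] := cover_small cA; rewrite ?Aa.
Qed.

Lemma card_covers : #|[set A | vcover D A & #|A| == a.+1]| = 'C(m, a.+1).
Proof.
have mn : (m <= n)%N by lia.
rewrite -(card_below mn) -cards_draws; apply: eq_card => A.
by rewrite !inE cover_cardE.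
Qed.

End FirstBlock.

Theorem theorem3p1 (K : fieldType) (n : nat) (u : 'X_{1..n})
    (B : {set 'I_n}) :
  squarefree u -> u <> 0%MM -> first_block u B ->
  (forall h : nat, ideal_height (borel_ideal K u) h ->
     forall P : {mpoly K[n]} -> Prop, is_ideal P ->
       ((minimal_prime (borel_ideal K u) P /\ prime_height P h) <->
        exists A : {set 'I_n},
          [/\ forall i, i \in A -> (i.+1 <= max_index B)%N, #|A| = h
            & ideal_eq P (var_ideal K A)]))
  /\ multiplicity (borel_ideal K u) 'C(max_index B, #|B|.-1).
Proof.
move=> sq _ /first_blockP [a []]; set m := max_index B.
move=> amn inblock geA neqm cB.
have upD := @dominated_up n (supp u).
have IE := @borel_idealE K n u sq.
have cge := cover_ge amn inblock geA neqm.
have cE := cover_cardE amn inblock geA neqm.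
have cex : exists2 A, vcover (dominated (supp u)) A & #|A| = a.+1.
  have an : (a.+1 <= n)%N by lia.
  exists (below_set n a.+1); last exact: card_below.
  apply: (below_cover amn inblock geA (card_below an)).
  by apply/subsetP => i; rewrite !inE; lia.
split=> [h /(mon_ideal_height upD IE cge cex) -> P _|].
  apply: iff_trans (minimal_prime_cover upD IE cge P) _.
  split=> -[A [+ Aa PA]] => [cA | Am]; exists A; split=> //.
    move=> i iA; have := cE A.
    rewrite cA Aa eqxx /= andbT => /esym/subsetP/(_ i iA).
    by rewrite inE.
  have := cE A; rewrite Aa eqxx !andbT => ->.
  by apply/subsetP => i /Am; rewrite inE.
have -> : 'C(m, #|B|.-1) = 'C(m, a.+1).
  by rewrite cB -bin_sub; [congr 'C(_, _); lia | lia].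
rewrite -(card_covers amn inblock geA neqm).
exact: (mon_multiplicity upD IE cge cex).
Qed.
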